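(* Let $k$ be a field, $n\ge 1$, and let $m_0,\ldots,m_n$ be an arithmetic sequence with $m_0\equiv 1 \pmod n$. Let $R=k[X_0,\ldots,X_n]$, let $\mathcal P$ be the kernel of the $k$-algebra map $R\to k[t]$, $X_i\mapsto t^{m_i}$, and let $k[\Gamma]=k[t^{m_0},\ldots,t^{m_n}]\cong R/\mathcal P$. Then $k[\Gamma]$ has a minimal free resolution over $R$ of the form $$0\to R^{n}\to R^{(n-1)\binom{n+1}{n}}\to\cdots\to R^{s\binom{n+1}{s+1}}\to\cdots\to R^{\binom{n+1}{2}}\to R\to k[\Gamma]\to 0.$$ In particular, the Betti numbers of $k[\Gamma]$ are $\beta_0=1$ and $\beta_s=s\binom{n+1}{s+1}$ for every $s\in[1,n]$.
   Context: A sequence of positive integers $m_0,\ldots,m_n$ is called an arithmetic sequence if: (i) $\gcd(m_0,\ldots,m_n)=1$; (ii) $0<m_0<\cdots<m_n$ and $m_i=m_0+id$ for all $i\in[1,n]$ for some integer $d$; (iii) $m_0,\ldots,m_n$ minimally generate the semigroup $\Gamma=\sum_i\mathbb N m_i$, i.e. $m_j\notin\sum_{i\neq j}\mathbb N m_i$ for every $j$. *)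

(* Defs.v *)
From HB Require Import structures.
From mathcomp Require Import all_boot all_algebra.
From mathcomp Require Import mpoly.
Set Implicit Arguments. Unset Strict Implicit. Unset Printing Implicit Defensive.
Import GRing.Theory.
Local Open Scope ring_scope.

Definition arithmetic_seq (n : nat) (m : nat -> nat) : Prop :=
  [/\ (\big[gcdn/0%N]_(i < n.+1) m i)%N = 1%N,
      (0 < m 0%N)%N /\ (forall i, (i < n)%N -> (m i < m i.+1)%N),
      (exists d : int, forall i, (i <= n)%N -> (m i)%:Z = (m 0%N)%:Z + i%:Z * d)
    & forall j, (j <= n)%N ->
        ~ exists c : nat -> nat,
            m j = (\sum_(i < n.+1 | i != j :> nat) c i * m i)%N].

Definition monomial_map (k : fieldType) (n : nat) (m : nat -> nat)
  (p : {mpoly k[n.+1]}) : {poly k} :=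
  mmap (@polyC k) (fun i : 'I_n.+1 => 'X^(m i)) p.

Definition monomial_kernel (k : fieldType) (n : nat) (m : nat -> nat)
  (p : {mpoly k[n.+1]}) : Prop := monomial_map m p = 0.

(* A finite free resolution of R/I over a commutative ring R:
     ... -> R^{b 2} --d 1--> R^{b 1} --d 0--> R^{b 0} = R -> R/I -> 0,
   elements of R^b are row vectors, d i : 'M_(b i.+1, b i) acts by v |-> v *m d i.
   Exactness: image of d 0 equals I (coker = R/I), and ker (d i) = im (d i.+1)
   for every i; eventually b i = 0 (finite length; exactness at the last
   nonzero term then says the last map is injective). *)
Definition free_resolution (R : comNzRingType) (I : R -> Prop)
  (b : nat -> nat) (d : forall i : nat, 'M[R]_(b i.+1, b i)) : Prop :=
  [/\ b 0%N = 1%N,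
      (forall x : R, I x <->
         exists v : 'rV[R]_(b 1%N), forall j0 : 'I_(b 0%N), (v *m d 0%N) 0 j0 = x),
      (forall i (v : 'rV[R]_(b i.+1)),
         v *m d i = 0 <-> exists w : 'rV[R]_(b i.+2), v = w *m d i.+1)
    & exists N, forall i, (N <= i)%N -> b i = 0%N].

(* Minimal free resolution over k[X_0..X_n]: all entries of all differentials
   lie in the homogeneous maximal ideal (X_0,...,X_n), i.e. have zero constant
   coefficient. *)
Definition minimal_free_resolution (k : fieldType) (n : nat)
  (I : {mpoly k[n.+1]} -> Prop) (b : nat -> nat)
  (d : forall i : nat, 'M[{mpoly k[n.+1]}]_(b i.+1, b i)) : Prop :=
  free_resolution I d /\
  forall i (r : 'I_(b i.+1)) (c : 'I_(b i)), ((d i) r c)@_0%MM = 0.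

(* Main.v *)
Require Import Defs.
From HB Require Import structures.
From mathcomp Require Import all_boot all_algebra.
From mathcomp Require Import mpoly.
From mathcomp Require Import zify ring.
(* Write m_0 = n a + 1 and let d be the common difference. The ideal P is generated by the
   2 x 2 minors of
       ( X_0 X_1 ... X_(n-1)  X_n^a     )
       ( X_1 X_2 ... X_n      X_0^(a+d) )
   and is resolved by the Eagon-Northcott complex of this matrix, whose s-th term is
   /\^(s+1) F (x) D_(s-1) with F = R^(n+1). With x and y the rows of the matrix, this complex
   is the total complex of a double complex built from the Koszul differentials dx and dy;
   as x is a regular sequence, it is acyclic as soon as ker dx /\ ker dy = im (dx dy) in
   positive exterior degree. That equality is proved by adding columns one at a time: the only
   obstruction is that z (x_j, y_j) in the span of the previous columns must force z to lie
   in the ideal I_j of their minors. Now I_j is the kernel of X_i |-> s t^i (i <= j), which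
   makes y_i = t x_i for all previous columns but not for the new one, so z is in I_j. *)

Set Implicit Arguments. Unset Strict Implicit. Unset Printing Implicit Defensive.
Import GRing.Theory.
Local Open Scope ring_scope.

(** * Koszul differentials and the Eagon-Northcott complex *)

Section Koszul.

Variable R : comNzRingType.
Implicit Types (xs ys : seq R) (cs : seq (R * R)) (f g : seq bool -> R).
Implicit Types (I J : seq bool).

(* [f : seq bool -> R] stands for the element of the exterior algebra of R^N with coefficient
   [f I] on e_I, where [I] is the indicator sequence of a subset; values at sequences of size
   other than [N] are irrelevant. The head of a sequence is the last column. *)
Definition eqg (N b : nat) f g : Prop :=
  forall I, size I = N -> count id I = b -> f I = g I.

(** Contraction with the linear form e_i |-> x_i. With f = f0 + e /\ f1 and e the head column, the
    clauses encode d(e /\ f1) = x f1 - e /\ d f1. *)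
Fixpoint bd (xs : seq R) (f : seq bool -> R) (I : seq bool) : R :=
  match xs, I with
  | x :: xs', false :: I' =>
      bd xs' (fun J => f (false :: J)) I' + x * f (true :: I')
  | _ :: xs', true :: I' => - bd xs' (fun J => f (true :: J)) I'
  | _, _ => 0
  end.

Lemma bd_local xs b f g :
  eqg (size xs) b.+1 f g -> eqg (size xs) b (bd xs f) (bd xs g).
Proof.
elim: xs b f g => [|x xs IH] b f g efg [|[] I] //= [sI] cI.
  case: b cI efg => // b [cI] efg; congr (- _); apply: IH sI cI => J sJ cJ.
  by apply: efg; rewrite /= ?sJ ?cJ.
congr (_ + _ * _).
  by apply: IH sI cI => J sJ cJ; apply: efg; rewrite /= ?sJ ?cJ.
by apply: efg; rewrite /= ?sI // -cI.
Qed.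

Lemma eq_bd xs f g I : f =1 g -> bd xs f I = bd xs g I.
Proof.
move=> efg; elim: xs f g efg I => [|x xs IH] f g efg [|[] I] //=.
  by congr (- _); apply: IH => J.
by rewrite efg; congr (_ + _); apply: IH => J.
Qed.

Lemma bd_lin xs a b f g I :
  bd xs (fun J => a * f J + b * g J) I = a * bd xs f I + b * bd xs g I.
Proof.
elim: xs f g I => [|x xs IH] f g [|[] I] //=; rewrite ?IH; ring.
Qed.

Lemma bdD xs f g I : bd xs (fun J => f J + g J) I = bd xs f I + bd xs g I.
Proof.
rewrite -[bd xs f I]mul1r -[bd xs g I]mul1r -bd_lin.
by apply: eq_bd => J; rewrite !mul1r.
Qed.

Lemma bdZ xs a f I : bd xs (fun J => a * f J) I = a * bd xs f I.
Proof.
have := bd_lin xs a 0 f f I; rewrite mul0r addr0 => <-.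
by apply: eq_bd => J; rewrite mul0r addr0.
Qed.

Lemma bdN xs f I : bd xs (fun J => - f J) I = - bd xs f I.
Proof. by rewrite -mulN1r -bdZ; apply: eq_bd => J; rewrite mulN1r. Qed.

Lemma bd_zero xs I : bd xs (fun=> 0) I = 0.
Proof. by have := bdZ xs 0 (fun=> 0) I; rewrite !mul0r. Qed.

Lemma bd_sum xs (A : Type) (r : seq A) (c : A -> R) (F : A -> seq bool -> R) I :
  bd xs (fun J => \sum_(i <- r) c i * F i J) I = \sum_(i <- r) c i * bd xs (F i) I.
Proof.
elim: r => [|i r IH].
  by rewrite big_nil -[RHS](bd_zero xs I); apply: eq_bd => J; rewrite big_nil.
rewrite big_cons -IH -bdZ -bdD; apply: eq_bd => J.
by rewrite big_cons.
Qed.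

Lemma bd_anticomm cs f I :
  bd (unzip1 cs) (bd (unzip2 cs) f) I = - bd (unzip2 cs) (bd (unzip1 cs) f) I.
Proof.
elim: cs f I => [|[x y] cs IH] f [|[] I] /=; rewrite ?oppr0 //.
  by rewrite !bdN IH.
rewrite !bdD !bdZ IH; ring.
Qed.

Lemma bd_bd xs f I : bd xs (bd xs f) I = 0.
Proof.
elim: xs f I => [|x xs IH] f [|[] I] //=.
  by rewrite bdN IH !oppr0.
rewrite bdD bdZ IH; ring.
Qed.

Definition zerov (T : Type) (xs : seq T) : seq bool := nseq (size xs) false.

Lemma zerovP (T : Type) (xs : seq T) I :
  size I = size xs -> count id I = 0%N -> I = zerov xs.
Proof.
rewrite /zerov => <-.
by elim: I => //= -[] I IH //= /IH {1}->.
Qed.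

Lemma count_zerov (T : Type) (xs : seq T) : count id (zerov xs) = 0%N.
Proof. by rewrite /zerov count_nseq mul0n. Qed.

Lemma size_zerov (T : Type) (xs : seq T) : size (zerov xs) = size xs.
Proof. by rewrite size_nseq. Qed.

(** The image of the Koszul differential in exterior degree 0, that is, the ideal generated by the
    entries of [xs]. *)
Definition ideal1 xs (z : R) : Prop := exists f, z = bd xs f (zerov xs).

Fixpoint regular_seq xs : Prop :=
  if xs is x :: xs' then
    (forall c, ideal1 xs' (x * c) -> ideal1 xs' c) /\ regular_seq xs'
  else True.

(** Write f = f0 + e /\ f1 with e the head column. Then f1 = d g1, by induction or, when f1 is a
    scalar, by regularity of x. Now f0 + x g1 is a cycle, hence some d g0, and f = d(g0 - e /\
    g1). *)
Lemma koszul_exact xs : regular_seq xs -> forall b f,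
  eqg (size xs) b (bd xs f) (fun=> 0) ->
  exists g, eqg (size xs) b.+1 f (bd xs g).
Proof.
elim: xs => [|x xs IH] /=; first by move=> _ b f _; exists f => -[].
move=> [regx /IH{}IH] b f fz.
pose f0 J := f (false :: J); pose f1 J := f (true :: J).
have f0z J : size J = size xs -> count id J = b -> bd xs f0 J = - (x * f1 J).
  move=> sJ cJ; apply/eqP; rewrite -addr_eq0; apply/eqP.
  by have := fz (false :: J); rewrite /= sJ cJ; apply.
have [g1 fg1] : exists g1, eqg (size xs) b f1 (bd xs g1).
  case: b fz f0z => [|b] fz f0z.
    have [g g1] : ideal1 xs (f1 (zerov xs)).
      apply: regx; exists (fun J => - f0 J).
      by rewrite bdN f0z ?opprK // ?size_zerov ?count_zerov.
    by exists g => I sI cI; rewrite (zerovP sI cI).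
  apply: IH => J sJ cJ; apply: oppr_inj; rewrite oppr0.
  by have := fz (true :: J); rewrite /= sJ cJ; apply.
have [|g0 fg0] := IH b (fun J => f0 J + x * g1 J).
  move=> J sJ cJ; rewrite bdD bdZ f0z // -fg1 //; ring.
exists (fun J => if J is c :: J' then if c then - g1 J' else g0 J' else 0).
move=> [|[] I] //= [sI] cI.
  by rewrite bdN opprK -fg1 //; case: cI.
by rewrite -fg0 // /f0; ring.
Qed.

Definition bd1 cs := bd (unzip1 cs).
Definition bd2 cs := bd (unzip2 cs).

(** Up to sign dx dy sends e_i /\ e_j to the minor x_i y_j - x_j y_i, so this is the ideal of 2 x 2
    minors. *)
Definition ideal2 cs (z : R) : Prop :=
  exists f, z = bd1 cs (bd2 cs f) (zerov cs).

(* The annihilator of a column in the cokernel of the preceding ones is the ideal of their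
   2 x 2 minors. *)
Fixpoint nice_columns cs : Prop :=
  if cs is c :: cs' then
    (forall z f, bd1 cs' f (zerov cs') = c.1 * z ->
                 bd2 cs' f (zerov cs') = c.2 * z -> ideal2 cs' z)
    /\ nice_columns cs'
  else True.

(** Write f = f0 + e /\ f1. Then f1 = dx dy g1, by induction or, in degree 0, by [nice_columns].
    Since dx dy (e /\ g1) = e /\ dx dy g1 + y dx g1 - x dy g1, subtracting it from f leaves f0 - y
    dx g1 + x dy g1, which both differentials kill and to which induction applies. *)
Lemma bd12_exact cs : nice_columns cs -> forall b f,
  eqg (size cs) b (bd1 cs f) (fun=> 0) -> eqg (size cs) b (bd2 cs f) (fun=> 0) ->
  exists g, eqg (size cs) b.+1 f (bd1 cs (bd2 cs g)).
Proof.
rewrite /bd1 /bd2.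
elim: cs => [|[x y] cs IH] /=; first by move=> _ b f _ _; exists f => -[].
move=> [nicex /IH{}IH] b f fx fy.
pose f0 J := f (false :: J); pose f1 J := f (true :: J).
have f0x J : size J = size cs -> count id J = b ->
    bd (unzip1 cs) f0 J = - (x * f1 J).
  move=> sJ cJ; apply/eqP; rewrite -addr_eq0; apply/eqP.
  by have := fx (false :: J); rewrite /= sJ cJ; apply.
have f0y J : size J = size cs -> count id J = b ->
    bd (unzip2 cs) f0 J = - (y * f1 J).
  move=> sJ cJ; apply/eqP; rewrite -addr_eq0; apply/eqP.
  by have := fy (false :: J); rewrite /= sJ cJ; apply.
have [g1 fg1] : exists g1,
    eqg (size cs) b f1 (bd (unzip1 cs) (bd (unzip2 cs) g1)).
  case: b fx fy f0x f0y => [|b] fx fy f0x f0y.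
    have [g g1] : ideal2 cs (f1 (zerov cs)).
      apply: (nicex _ (fun J => - f0 J));
      by rewrite /bd1 /bd2 bdN ?f0x ?f0y ?opprK // ?size_zerov ?count_zerov.
    by exists g => I sI cI; rewrite (zerovP sI cI).
  apply: IH => J sJ cJ; apply: oppr_inj; rewrite oppr0.
    by have := fx (true :: J); rewrite /= sJ cJ; apply.
  by have := fy (true :: J); rewrite /= sJ cJ; apply.
have [||g0 fg0] := IH b (fun J => f0 J +
    (- y * bd (unzip1 cs) g1 J + x * bd (unzip2 cs) g1 J)).
- move=> J sJ cJ; rewrite bdD bd_lin bd_bd f0x // -fg1 //; ring.
- move=> J sJ cJ; rewrite bdD bd_lin bd_bd f0y // fg1 // bd_anticomm; ring.
exists (fun J => if J is c :: J' then if c then g1 J' else g0 J' else 0).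
move=> [|[] I] //= [sI] cI.
  by rewrite bdN opprK -fg1 //; case: cI.
rewrite bdD bdZ -fg0 // /f0; ring.
Qed.

(* [z a] is the component in the summand indexed by u^(a) v^(s - 1 - a). *)
Lemma eagon_northcott_exact cs s (z : nat -> seq bool -> R) :
    regular_seq (unzip1 cs) -> nice_columns cs ->
    (forall a, (a < s)%N -> eqg (size cs) s.+1
       (fun J => bd1 cs (z a.+1) J + bd2 cs (z a) J) (fun=> 0)) ->
    (s = 0%N -> eqg (size cs) 0 (bd1 cs (bd2 cs (z 0%N))) (fun=> 0)) ->
  exists w : nat -> seq bool -> R, forall a, (a <= s)%N ->
    eqg (size cs) s.+2 (z a) (fun J => bd1 cs (w a.+1) J + bd2 cs (w a) J).
Proof.
rewrite /bd1 /bd2 => reg nice zz z0.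
have kos b f : eqg (size cs) b (bd (unzip1 cs) f) (fun=> 0) ->
    exists g, eqg (size cs) b.+1 f (bd (unzip1 cs) g).
  by have := koszul_exact reg (b := b) (f := f); rewrite size_map.
have loc1 b f g : eqg (size cs) b.+1 f g ->
    eqg (size cs) b (bd (unzip1 cs) f) (bd (unzip1 cs) g).
  by have := @bd_local (unzip1 cs) b f g; rewrite size_map.
have loc2 b f g : eqg (size cs) b.+1 f g ->
    eqg (size cs) b (bd (unzip2 cs) f) (bd (unzip2 cs) g).
  by have := @bd_local (unzip2 cs) b f g; rewrite size_map.
(* By the cycle condition dx z_0 lies in ker dx and in ker dy, so dx z_0 = dx dy w_0. Then z_0 - dy
   w_0 is a dx-cycle, which gives w_1. *)
have [||w0 w0P] := @bd12_exact cs nice s (bd (unzip1 cs) (z 0%N)).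
- by move=> I _ _; exact: bd_bd.
- rewrite /bd2; move=> I sI cI; case: s zz z0 cI => [|s] zz z0 cI.
    by apply: oppr_inj; rewrite -bd_anticomm oppr0; apply: z0.
  have /loc1/(_ I sI cI) := zz 0%N isT.
  rewrite bdD bd_bd add0r bd_zero bd_anticomm => /eqP.
  by rewrite oppr_eq0 => /eqP.
have [|w1 w1P] := kos s.+1 (fun J => z 0%N J - bd (unzip2 cs) w0 J).
  by move=> I sI cI; rewrite bdD bdN w0P // subrr.
suff H a : (a <= s)%N -> exists w : nat -> seq bool -> R,
    forall a', (a' <= a)%N -> eqg (size cs) s.+2 (z a')
       (fun J => bd (unzip1 cs) (w a'.+1) J + bd (unzip2 cs) (w a') J).
  exact: H s (leqnn s).
elim: a => [_|a IH las].
  exists (fun i => if i is 0%N then w0 else w1) => -[] // _ I sI cI.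
  by rewrite -w1P // subrK.
have [w wP] := IH (ltnW las).
(* Staircase: by anticommutation and the equation already solved at a, z_(a+1) - dy w_(a+1) is a
   dx-cycle, which gives w_(a+2). *)
have [|v vP] := kos s.+1 (fun J => z a.+1 J - bd (unzip2 cs) (w a.+1) J).
  move=> I sI cI; rewrite bdD bdN bd_anticomm opprK.
  rewrite -[RHS](zz a las I) //; congr (_ + _).
  rewrite (loc2 _ _ _ (wP a (leqnn a)) I) // bdD bd_bd.
  by rewrite addr0.
exists (fun i => if i == a.+2 then v else w i) => i.
rewrite leq_eqVlt => /predU1P[-> | lia'] I sI cI.
  by rewrite eqxx ltn_eqF //= -vP // subrK.
rewrite !ltn_eqF //; try exact: wP.
by apply: (leq_trans lia').
Qed.

(** * Ideals generated by minors and by entries *)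

Section Ideal2.

Variable cs : seq (R * R).

Lemma ideal2_0 : ideal2 cs 0.
Proof.
exists (fun=> 0); rewrite -[LHS](bd_zero (unzip1 cs) (zerov cs)).
by apply: eq_bd => I; rewrite /bd2 bd_zero.
Qed.

Lemma ideal2D z w : ideal2 cs z -> ideal2 cs w -> ideal2 cs (z + w).
Proof.
move=> [f ->] [g ->]; exists (fun J => f J + g J).
by rewrite /bd1 /bd2 -bdD; apply: eq_bd => I; rewrite bdD.
Qed.

Lemma ideal2M a z : ideal2 cs z -> ideal2 cs (a * z).
Proof.
move=> [f ->]; exists (fun J => a * f J).
by rewrite /bd1 /bd2 -bdZ; apply: eq_bd => I; rewrite bdZ.
Qed.

End Ideal2.

Lemma ideal2_cons c cs z : ideal2 cs z -> ideal2 (c :: cs) z.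
Proof.
case: c => x y [f ->].
exists (fun J => if J is false :: J' then f J' else 0) => /=.
by rewrite /bd1 /bd2 /= bd_zero oppr0 !mulr0 addr0; apply: eq_bd => I; rewrite addr0.
Qed.

Lemma mem_column c cs : c \in cs -> exists f,
  bd1 cs f (zerov cs) = c.1 /\ bd2 cs f (zerov cs) = c.2.
Proof.
rewrite /bd1 /bd2; elim: cs => //= d cs IH; rewrite inE => /predU1P[-> | /IH[f [f1 f2]]].
  exists (fun J => if J is true :: _ then 1 else 0).
  by rewrite !bd_zero !add0r !mulr1.
exists (fun J => if J is false :: J' then f J' else 0).
by rewrite !mulr0 !addr0.
Qed.

(** The minor is the image of the wedge of two basis vectors. With one of them the head column, the
    other comes from [mem_column]. *)
Lemma minor_ideal2 c d cs :
  c \in cs -> d \in cs -> ideal2 cs (c.1 * d.2 - d.1 * c.2).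
Proof.
elim: cs => //= e cs IH; rewrite !inE.
have head d' : d' \in cs -> ideal2 (e :: cs) (d'.1 * e.2 - e.1 * d'.2).
  move=> /mem_column[f [<- <-]].
  exists (fun J => if J is true :: J' then f J' else 0).
  case: e => x y; rewrite /bd1 /bd2 /= bdD bdZ.
  rewrite (@eq_bd _ (bd _ (fun=> 0)) (fun=> 0) _ (bd_zero _)) bd_zero; ring.
move=> /predU1P[-> | cc] /predU1P[-> | dd].
- by rewrite subrr; apply: ideal2_0.
- by rewrite -opprB -mulN1r; apply/ideal2M/head.
- exact: head.
- exact/ideal2_cons/IH.
Qed.

Lemma ideal1_0 xs : ideal1 xs 0.
Proof. by exists (fun=> 0); rewrite bd_zero. Qed.

Lemma ideal1D xs z w : ideal1 xs z -> ideal1 xs w -> ideal1 xs (z + w).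
Proof. by move=> [f ->] [g ->]; exists (fun J => f J + g J); rewrite bdD. Qed.

Lemma ideal1M xs a z : ideal1 xs z -> ideal1 xs (a * z).
Proof. by move=> [f ->]; exists (fun J => a * f J); rewrite bdZ. Qed.

Lemma mem_ideal1 x xs : x \in xs -> ideal1 xs x.
Proof.
move=> xxs; have [|f []] := @mem_column (x, x) (zip xs xs).
  by elim: xs xxs => //= y xs IH; rewrite !inE => /predU1P[->|/IH->]; rewrite ?eqxx ?orbT.
rewrite /bd1 /bd2 unzip1_zip // /zerov size_zip minnn => fx _.
by exists f; rewrite fx.
Qed.

(** * The Eagon-Northcott complex in bases and matrices *)

Fixpoint subsets (N k : nat) : seq (seq bool) :=
  match N, k with
  | 0, 0 => [:: [::]]
  | 0, _.+1 => [::]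
  | N'.+1, 0 => map (cons false) (subsets N' 0)
  | N'.+1, k'.+1 => map (cons false) (subsets N' k) ++ map (cons true) (subsets N' k')
  end%N.

Lemma size_subsets N k : size (subsets N k) = 'C(N, k).
Proof.
elim: N k => [|N IH] [|k] //=; first by rewrite size_map IH !bin0.
by rewrite size_cat !size_map !IH binS.
Qed.

Lemma mem_subsets N k I :
  (I \in subsets N k) = (size I == N) && (count id I == k).
Proof.
elim: N k I => [|N IH] k I; first by case: k I => [|k] [|c I].
have inj (c : bool) : injective (cons c) by move=> ? ? [].
have memF : forall c J s, (c :: J \in map (cons (~~ c)) s) = false.
  by move=> c J s; apply/negP => /mapP[? _ []]; case: c.
case: k I => [|k] [|[] I] /=.
- by apply/negP => /mapP[].
- by rewrite (memF true) andbF.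
- by rewrite mem_map // IH.
- by apply/negP; rewrite mem_cat => /orP[] /mapP[].
- by rewrite mem_cat (memF true) mem_map // IH.
- by rewrite mem_cat (memF false) orbF mem_map // IH.
Qed.

Lemma uniq_subsets N k : uniq (subsets N k).
Proof.
have inj c : injective (cons (c : bool)) by move=> ? ? [].
elim: N k => [|N IH] [|k] //=; first by rewrite map_inj_uniq.
rewrite cat_uniq !map_inj_uniq // !IH /= andbT.
by apply/hasPn => _ /mapP[I _ ->]; apply/negP => /mapP[].
Qed.

(** The pair (J, a) stands for e_J (x) u^(a) v^(s-1-a) in /\^(s+1) F (x) D_(s-1). *)
Definition en_basis (N s : nat) : seq (seq bool * nat)%type :=
  if s is 0 then [:: (nseq N false, 0%N)]
  else [seq (J, a) | J <- subsets N s.+1, a <- iota 0 s].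

Lemma size_en_basis N s : (0 < s)%N ->
  size (en_basis N s) = (s * 'C(N, s.+1))%N.
Proof. by case: s => // s _; rewrite size_allpairs size_iota size_subsets mulnC. Qed.

Lemma mem_en_basis N s I a : ((I, a) \in en_basis N s.+1) =
  [&& size I == N, count id I == s.+2 & (a <= s)%N].
Proof.
apply/allpairsP/idP => [[[J b] []] | /and3P[sI cI las]].
  by rewrite mem_subsets mem_iota add0n ltnS /= => sJ lbs [-> ->]; rewrite lbs andbT.
by exists (I, a); rewrite mem_subsets mem_iota add0n /= sI cI ltnS.
Qed.

Lemma uniq_en_basis N s : uniq (en_basis N s).
Proof.
case: s => // s; apply: allpairs_uniq; [exact: uniq_subsets|exact: iota_uniq|].
by case=> ? ? [? ?] _ _ [-> ->].
Qed.

(** In divided powers dx lowers the exponent of u and dy that of v, both with coefficient 1. The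
    last map, onto the ideal of minors, is dx dy. *)
Definition en_diff cs s (F : seq bool * nat -> R) (q : seq bool * nat) : R :=
  if s is 0 then bd1 cs (bd2 cs (fun I => F (I, 0%N))) q.1
  else bd1 cs (fun I => F (I, q.2.+1)) q.1 + bd2 cs (fun I => F (I, q.2)) q.1.

Lemma en_diff_sum cs s (A : Type) (r : seq A) (c : A -> R)
    (F : A -> seq bool * nat -> R) q :
  en_diff cs s (fun t => \sum_(i <- r) c i * F i t) q =
  \sum_(i <- r) c i * en_diff cs s (F i) q.
Proof.
case: s => [|s] /=; rewrite /bd1 /bd2.
  rewrite -bd_sum; apply: eq_bd => I; exact: bd_sum.
rewrite !bd_sum -big_split /=; apply: eq_bigr => i _; ring.
Qed.

Lemma bd1_local cs b f g :
  eqg (size cs) b.+1 f g -> eqg (size cs) b (bd1 cs f) (bd1 cs g).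
Proof. by have := @bd_local (unzip1 cs) b f g; rewrite size_map. Qed.

Lemma bd2_local cs b f g :
  eqg (size cs) b.+1 f g -> eqg (size cs) b (bd2 cs f) (bd2 cs g).
Proof. by have := @bd_local (unzip2 cs) b f g; rewrite size_map. Qed.

Lemma en_diff_local cs s F G :
  {in en_basis (size cs) s.+1, F =1 G} ->
  {in en_basis (size cs) s, en_diff cs s F =1 en_diff cs s G}.
Proof.
move=> eFG [J b]; case: s eFG => [|s] eFG.
  rewrite inE => /eqP[-> _]; apply: bd1_local; rewrite ?size_nseq ?count_nseq //.
  apply: bd2_local => I sI cI; apply: eFG.
  by rewrite mem_en_basis sI cI !eqxx.
rewrite mem_en_basis => /and3P[/eqP sJ /eqP cJ lbs]; congr (_ + _).
  apply: bd1_local sJ cJ => I sI cI; apply: eFG.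
  by rewrite mem_en_basis sI cI !eqxx.
apply: bd2_local sJ cJ => I sI cI; apply: eFG.
by rewrite mem_en_basis sI cI !eqxx leqW.
Qed.

Lemma en_diff_diff cs s F q : en_diff cs s (en_diff cs s.+1 F) q = 0.
Proof.
have bd_bd2 f I : bd (unzip2 cs) (bd (unzip1 cs) f) I =
    - bd (unzip1 cs) (bd (unzip2 cs) f) I by rewrite bd_anticomm opprK.
case: s => [|s] /=; rewrite /bd1 /bd2; last first.
  rewrite !bdD !bd_bd bd_bd2; ring.
rewrite (@eq_bd _ _ (fun I => - bd (unzip1 cs) (bd (unzip2 cs)
  (fun J => F (J, 1%N))) I)); last first.
  by move=> I; rewrite bdD bd_bd bd_bd2 addr0.
by rewrite bdN bd_bd oppr0.
Qed.

Definition en_rank (N s : nat) : nat := size (en_basis N s).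

Definition basis_fun N s (r : 'I_(en_rank N s)) (t : seq bool * nat) : R :=
  (t == tnth (in_tuple (en_basis N s)) r)%:R.

Definition en_mx cs s : 'M[R]_(en_rank (size cs) s.+1, en_rank (size cs) s) :=
  \matrix_(r, c) en_diff cs s (basis_fun r) (tnth (in_tuple (en_basis (size cs) s)) c).

(** Passes from row vectors to coefficient functions, extended by 0 off [en_basis], so that
    exactness can be proved on functions. *)
Definition vec_fun N s (v : 'rV[R]_(en_rank N s)) t : R :=
  \sum_r v 0 r * basis_fun r t.

Lemma vec_funE N s (v : 'rV[R]_(en_rank N s)) r :
  vec_fun v (tnth (in_tuple (en_basis N s)) r) = v 0 r.
Proof.
have /tuple_uniqP inj : uniq (in_tuple (en_basis N s)) := uniq_en_basis N s.
rewrite /vec_fun (bigD1 r) //= /basis_fun eqxx mulr1 big1 ?addr0 // => i nir.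
by rewrite (inj_eq inj) eq_sym (negPf nir) mulr0.
Qed.

Lemma mem_basis_tnth N s r : tnth (in_tuple (en_basis N s)) r \in en_basis N s.
Proof. exact: (mem_tnth r (in_tuple (en_basis N s))). Qed.

Lemma tnth_basis N s t : t \in en_basis N s ->
  exists r, t = tnth (in_tuple (en_basis N s)) r.
Proof. by case/(tnthP (in_tuple (en_basis N s))) => r ->; exists r. Qed.

Lemma mul_en_mx cs s (v : 'rV_(en_rank (size cs) s.+1)) c :
  (v *m en_mx cs s) 0 c =
  en_diff cs s (vec_fun v) (tnth (in_tuple (en_basis (size cs) s)) c).
Proof.
rewrite /vec_fun en_diff_sum mxE.
by apply: eq_bigr => r _; rewrite mxE.
Qed.

Lemma vec_fun_mul cs s (v : 'rV_(en_rank (size cs) s.+1)) :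
  {in en_basis (size cs) s, vec_fun (v *m en_mx cs s) =1 en_diff cs s (vec_fun v)}.
Proof. by move=> t /tnth_basis[r ->]; rewrite vec_funE mul_en_mx. Qed.

Lemma vec_fun_row N s (w : seq bool * nat -> R) :
  {in en_basis N s,
    vec_fun (\row_r w (tnth (in_tuple (en_basis N s)) r)) =1 w}.
Proof. by move=> t /tnth_basis[r ->]; rewrite vec_funE mxE. Qed.

Lemma eagon_northcott_free_resolution cs (I : R -> Prop) :
    regular_seq (unzip1 cs) -> nice_columns cs ->
    (forall z, I z <-> ideal2 cs z) ->
  free_resolution I (en_mx cs).
Proof.
move=> reg nice Icol; split=> //.
- move=> z; rewrite Icol; split=> [[f ->]|[v]].
    exists (\row_r f (tnth (in_tuple (en_basis (size cs) 1)) r).1) => j.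
    rewrite mul_en_mx.
    have := @vec_fun_row (size cs) 1 (fun t => f t.1) => /(@en_diff_local cs 0).
    rewrite ord1 => -> //; apply: mem_basis_tnth.
  move=> /(_ ord0); rewrite mul_en_mx (tnth_nth (nseq (size cs) false, 0%N)) /= => <-.
  by exists (fun J => vec_fun v (J, 0%N)).
- move=> s v; split=> [v0 | [w ->]]; last first.
    apply/rowP => c; rewrite mul_en_mx mxE.
    rewrite (@en_diff_local _ _ _ _ (@vec_fun_mul cs s.+1 w)) ?mem_basis_tnth //.
    exact: en_diff_diff.
  have dv t : t \in en_basis (size cs) s -> en_diff cs s (vec_fun v) t = 0.
    by move=> /tnth_basis[r ->]; rewrite -mul_en_mx v0 mxE.
  have [||w wP] := @eagon_northcott_exact cs s (fun a J => vec_fun v (J, a)) reg nice.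
  + move=> a; case: s v v0 dv => // s v v0 dv las J sJ cJ.
    by apply: (dv (J, a)); rewrite mem_en_basis sJ cJ !eqxx.
  + move=> s0; move: v v0 dv; rewrite s0 => v _ dv J sJ cJ.
    by apply: (dv (J, 0%N)); rewrite (zerovP sJ cJ) inE.
  exists (\row_r (fun t => w t.2 t.1) (tnth (in_tuple (en_basis (size cs) s.+2)) r)).
  apply/rowP => r; rewrite -vec_funE mul_en_mx.
  rewrite (@en_diff_local _ _ _ _ (@vec_fun_row _ _ (fun t => w t.2 t.1))) ?mem_basis_tnth //.
  case: (tnth _ r) (mem_basis_tnth r) => J a.
  rewrite mem_en_basis => /and3P[/eqP sJ /eqP cJ las].
  exact: wP.
- exists (size cs).+1 => -[|s] // lNs.
  by rewrite /en_rank size_en_basis // bin_small ?muln0 // leqW.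
Qed.

Lemma bd_scale t xs f I : bd (map ( *%R t) xs) f I = t * bd xs f I.
Proof.
elim: xs f I => [|x xs IH] f [|[] I] /=; rewrite ?mulr0 // IH; ring.
Qed.

End Koszul.

(** * Ring morphisms under which the second row is a multiple of the first *)

Section Morphism.

Variables (R S : comNzRingType) (chi : {rmorphism R -> S}).

Lemma rmorph_bd (xs : seq R) f I :
  chi (bd xs f I) = bd (map chi xs) (fun J => chi (f J)) I.
Proof.
elim: xs f I => [|x xs IH] f [|[] I] /=; rewrite ?rmorph0 //.
  by rewrite rmorphN IH.
by rewrite rmorphD rmorphM IH.
Qed.

Variables (t : S) (cs : seq (R * R)).
Hypothesis chi_cs : forall c, c \in cs -> chi c.2 = t * chi c.1.

Lemma rmorph_bd2 f I : chi (bd2 cs f I) = t * chi (bd1 cs f I).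
Proof.
rewrite /bd1 /bd2 !rmorph_bd -bd_scale -!map_comp.
by congr (bd _ _ _); apply/eq_in_map => c /chi_cs.
Qed.

(** Under [chi] the composite dx dy becomes t dx dx = 0. *)
Lemma ideal2_ker z : ideal2 cs z -> chi z = 0.
Proof.
move=> [f ->]; rewrite /bd1 rmorph_bd.
under eq_bd do rewrite rmorph_bd2 /bd1 rmorph_bd.
by rewrite bdZ bd_bd mulr0.
Qed.

End Morphism.

(** Applying [chi] to both relations gives t chi(x) chi(z) = chi(y) chi(z), and chi(z) can be
    isolated in a domain. *)
Lemma rmorph_column (R : comNzRingType) (S : idomainType) (chi : {rmorphism R -> S})
    (t : S) (cs : seq (R * R)) :
    (forall c, c \in cs -> chi c.2 = t * chi c.1) ->
  forall x y z f, t * chi x != chi y ->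
    bd1 cs f (zerov cs) = x * z -> bd2 cs f (zerov cs) = y * z -> chi z = 0.
Proof.
move=> chi_cs x y z f xy fx fy; apply/eqP.
have := rmorph_bd2 chi_cs f (zerov cs); rewrite fx fy !rmorphM mulrA => /esym/eqP.
by rewrite -subr_eq0 -mulrBl mulf_eq0 subr_eq0 (negPf xy).
Qed.

(** * Minimality of the complex *)

Section Minimal.

Variables (R S : comNzRingType) (chi : {rmorphism R -> S}) (cs : seq (R * R)).
Hypothesis chi_cs : forall c, c \in cs -> chi c.1 = 0 /\ chi c.2 = 0.

Lemma en_mx_minimal s r c : chi (en_mx cs s r c) = 0.
Proof.
have bd10 f I : chi (bd1 cs f I) = 0.
  (* A row of zeros is written as 0 times itself, so that [bd_scale] gives the vanishing. *)
  rewrite /bd1 rmorph_bd -map_comp (_ : map _ _ = map ( *%R 0) (map chi (unzip1 cs))).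
    by rewrite bd_scale mul0r.
  rewrite -!map_comp; apply/eq_in_map => x /chi_cs[/= -> _].
  by rewrite mul0r.
have bd20 f I : chi (bd2 cs f I) = 0.
  rewrite (@rmorph_bd2 _ _ _ 0) ?mul0r // => x /chi_cs[_ ->].
  by rewrite mul0r.
rewrite mxE; case: s r c => [|s] r c /=; first exact: bd10.
by rewrite rmorphD bd10 bd20 addr0.
Qed.

End Minimal.

(** * Binomial ideals *)

Section IdealPred.

Variables (R : comNzRingType) (J : R -> Prop).

Definition is_ideal : Prop :=
  [/\ J 0, forall z w, J z -> J w -> J (z + w) & forall a z, J z -> J (a * z)].

Hypothesis idJ : is_ideal.

Lemma is_ideal_sum (A : eqType) (r : seq A) (F : A -> R) :
  (forall i, i \in r -> J (F i)) -> J (\sum_(i <- r) F i).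
Proof.
case: idJ => J0 JD _; elim: r => [|i r IH] JF; first by rewrite big_nil.
rewrite big_cons; apply: JD; first by apply: JF; rewrite mem_head.
by apply: IH => l lr; apply: JF; rewrite inE lr orbT.
Qed.

Lemma congJ_refl z : J (z - z).
Proof. by case: idJ => J0 _ _; rewrite subrr. Qed.

Lemma congJ_sym z w : J (z - w) -> J (w - z).
Proof. by case: idJ => _ _ JM zw; rewrite -opprB -mulN1r; apply: JM. Qed.

Lemma congJ_trans w z v : J (z - w) -> J (w - v) -> J (z - v).
Proof. by case: idJ => _ JD _ zw wv; rewrite -(subrKA w); apply: JD. Qed.

Lemma congJ_mul a z w : J (z - w) -> J (a * z - a * w).
Proof. by case: idJ => _ _ JM; rewrite -mulrBr; apply: JM. Qed.

End IdealPred.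

Lemma ideal1_is_ideal (R : comNzRingType) (xs : seq R) : is_ideal (ideal1 xs).
Proof. by split; [exact: ideal1_0|exact: ideal1D|exact: ideal1M]. Qed.

Lemma ideal2_is_ideal (R : comNzRingType) (cs : seq (R * R)) : is_ideal (ideal2 cs).
Proof. by split; [exact: ideal2_0|exact: ideal2D|exact: ideal2M]. Qed.

Lemma mnm_ind N (P : 'X_{1..N} -> Prop) :
  P 0%MM -> (forall i m, P m -> P (U_(i) + m)%MM) -> forall m, P m.
Proof.
move=> P0 PS m; have [e] := ubnP (mdeg m); elim: e m => // e IH m.
have [-> // | m_neq0] := eqVneq m 0%MM.
have [i mi] : exists i, (0 < m i)%N.
  apply/existsP; rewrite -[X in is_true X]negbK negb_exists.
  apply: contra m_neq0 => /forallP m0; apply/eqP/mnmP => i.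
  by rewrite mnm0E; apply/eqP; rewrite -leqn0 leqNgt.
have le1 : (U_(i) <= m)%MM.
  by apply/mnm_lepP => l; rewrite mnm1E; case: eqP => [<-|].
have mE : m = (U_(i) + (m - U_(i)))%MM by rewrite addmC submK.
rewrite mE mdegD mdeg1 ltnS => lt_e.
exact/PS/IH.
Qed.

Section Binomial.

Variables (k : fieldType) (N : nat) (J : {mpoly k[N]} -> Prop).
Hypothesis idJ : is_ideal J.

Lemma mpoly_mon_ideal p : (forall m, m \in msupp p -> J 'X_[m]) -> J p.
Proof.
move=> JX; rewrite [p]mpolyE; apply: is_ideal_sum => // m /JX.
by case: idJ => _ _ JM; rewrite -mul_mpolyC; apply: JM.
Qed.

(* The second hypothesis says that the monomial map with exponents [w] kills [p]. *)
Lemma binomial_ideal (W : eqType) (w : 'X_{1..N} -> W) (p : {mpoly k[N]}) :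
    (forall m1 m2, w m1 = w m2 -> J ('X_[m1] - 'X_[m2])) ->
    (forall x, \sum_(m <- msupp p | w m == x) p@_m = 0) ->
  J p.
Proof.
move=> Jw p0.
(* One monomial of p is fixed in each weight that occurs. Replacing every monomial by its
   representative changes p only modulo J, and the result is zero because coefficients of equal
   weight sum to zero. *)
pose rep x : 'X_{1..N} := nth 0%MM (msupp p) (find (fun m => w m == x) (msupp p)).
have wrep m : m \in msupp p -> w (rep (w m)) = w m.
  move=> mp; apply/eqP/(nth_find 0%MM (a := fun m' => w m' == w m))/hasP.
  by exists m.
have: \sum_(m <- msupp p) p@_m *: ('X_[rep (w m)] : {mpoly k[N]}) = 0.
  rewrite (eq_big_seq (fun m => \sum_(x <- undup (map w (msupp p)))
      (if w m == x then p@_m else 0) *: ('X_[rep x] : {mpoly k[N]}))); last first.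
    move=> m mp; rewrite (bigD1_seq (w m)) ?undup_uniq ?mem_undup ?map_f //= eqxx.
    by rewrite big1 ?addr0 // => x; rewrite eq_sym => /negPf->; rewrite scale0r.
  rewrite exchange_big big1 //= => x _.
  by rewrite -scaler_suml -big_mkcond p0 scale0r.
move=> repE; rewrite -[X in J X]subr0 -repE [X in J (X - _)]mpolyE -sumrB; apply: is_ideal_sum => // m mp.
rewrite -scalerBr -mul_mpolyC; case: idJ => _ _; apply; apply: Jw.
by rewrite wrep.
Qed.

End Binomial.

(** P is not assumed to be an ideal: it will be the vanishing of one coefficient. *)
Lemma bd_pred (S : comNzRingType) (P : S -> Prop) (xs : seq S) :
    P 0 -> (forall z w, P z -> P w -> P (z + w)) -> (forall z, P z -> P (- z)) ->
    (forall x r, x \in xs -> P (x * r)) ->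
  forall f I, P (bd xs f I).
Proof.
move=> P0 PD PN; elim: xs => [|x xs IH] Px f [|[] I] //=.
  by apply/PN/IH => y r yxs; apply: Px; rewrite inE yxs orbT.
apply: PD; last by apply: Px; rewrite mem_head.
by apply: IH => y r yxs; apply: Px; rewrite inE yxs orbT.
Qed.

(** * The columns (X_i, X_(i+1)) and normal forms modulo their minors *)

Section Columns.

Variables (k : fieldType) (n : nat).
Notation R := {mpoly k[n.+1]}.

(** Natural indices spare ordinal arithmetic; beyond n, [inord] falls back to 0. *)
Definition X (i : nat) : R := 'X_(inord i).

Fixpoint cols (j : nat) : seq (R * R) :=
  if j is j'.+1 then (X j', X j'.+1) :: cols j' else [::].

Lemma cols_mem i j : (i < j)%N -> (X i, X i.+1) \in cols j.
Proof.
elim: j => // j IH; rewrite ltnS leq_eqVlt inE => /predU1P[->|/IH->].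
  by rewrite eqxx.
by rewrite orbT.
Qed.

Lemma memcolsP j c : c \in cols j -> exists2 i, (i < j)%N & c = (X i, X i.+1).
Proof.
elim: j => //= j IH; rewrite inE => /predU1P[->|/IH[i lij ->]]; first by exists j.
by exists i => //; apply: ltnW.
Qed.

(** With the converse [ideal1_cols], membership in (X_0, ..., X_(j-1)) becomes a condition on
    coefficients: no monomial of p avoids all these variables. *)
Lemma mcoeff_ideal1_cols j (p : R) (m : 'X_{1..n.+1}) : (j <= n.+1)%N ->
  ideal1 (unzip1 (cols j)) p -> (forall i : 'I_n.+1, (i < j)%N -> m i = 0%N) ->
  p@_m = 0.
Proof.
move=> lejn [f ->] m0; apply: (bd_pred (P := fun p : R => p@_m = 0)).
- exact: mcoeff0.
- by move=> z w z0 w0; rewrite mcoeffD z0 w0 addr0.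
- by move=> z z0; rewrite mcoeffN z0 oppr0.
move=> x r /mapP[c /memcolsP[i lij ->] ->] /=.
rewrite mulrC mcoeffMr big1 // => -[m1 m2] /= /eqP mE.
rewrite mcoeffX; case: eqP => [m2E|]; last by rewrite mulr0.
have lin : (i < n.+1)%N := leq_trans lij lejn.
have := congr1 (fun m' : 'X_{1..n.+1} => m' (inord i)) mE.
by rewrite /= m0 ?inordK // mnmDE -m2E mnm1E eqxx.
Qed.

Lemma ideal1_cols j (p : R) : (j <= n.+1)%N ->
  (forall m : 'X_{1..n.+1}, (forall i : 'I_n.+1, (i < j)%N -> m i = 0%N) -> p@_m = 0) ->
  ideal1 (unzip1 (cols j)) p.
Proof.
move=> lejn p0; apply: mpoly_mon_ideal; first exact: ideal1_is_ideal.
move=> m; rewrite mcoeff_msupp => pm.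
have [i /andP[lij mi]] : exists i : 'I_n.+1, (i < j)%N && (0 < m i)%N.
  apply/existsP; apply: contraNT pm; rewrite negb_exists => /forallP m0.
  apply/eqP/p0 => i lij; have := m0 i.
  by rewrite lij /= lt0n negbK => /eqP.
have le1 : (U_(i) <= m)%MM.
  by apply/mnm_lepP => l; rewrite mnm1E; case: eqP => [<-|].
rewrite -(submK le1) mpolyXD; apply/ideal1M/mem_ideal1.
apply/mapP; exists (X i, X i.+1); first exact: cols_mem.
by rewrite /X /= inord_val.
Qed.

(** Multiplication by X_j^e shifts monomials without touching the exponents of X_0, ..., X_(j-1).
    The exponent e serves the entry X_n^a of the last column. *)
Lemma regular_column j e (c : R) : (j <= n)%N ->
  ideal1 (unzip1 (cols j)) (X j ^+ e * c) -> ideal1 (unzip1 (cols j)) c.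
Proof.
move=> lejn Jc; apply: ideal1_cols => [|m m0]; first exact: leqW.
rewrite -(mcoeffMX c (U_(inord j) *+ e)) -mpolyXn mulrC.
apply: mcoeff_ideal1_cols Jc _ => [|i lij]; first exact: leqW.
rewrite mnmDE mulmnE mnm1E m0 // addn0.
case: eqP => [ij|]; last by rewrite mul0n.
by move: lij; rewrite -ij inordK ?ltnn.
Qed.

Lemma regular_cols j : (j <= n.+1)%N -> regular_seq (unzip1 (cols j)).
Proof.
elim: j => //= j IH ltjn; split; last exact/IH/ltnW.
by move=> c; rewrite -{1}[X j]expr1; apply: regular_column.
Qed.

(* The greedy product of [r] variables among X_0 .. X_j with index sum [S] (for S <= r j);
   all such products are congruent modulo the minors of the first [j] columns. *)
Fixpoint mon (j r S : nat) : R :=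
  if r is r'.+1 then X (minn S j) * mon j r' (S - j) else 1.

Section Congruence.

Variables (J : R -> Prop) (j : nat).
Hypotheses (idJ : is_ideal J)
  (Jminor : forall i l, (i < j)%N -> (l < j)%N -> J (X i.+1 * X l - X i * X l.+1)).

Lemma shift_cong e i l : (i + e <= j)%N -> (l + e <= j)%N ->
  J (X (i + e) * X l - X i * X (l + e)).
Proof.
elim: e l => [|e IH] l lie lle; first by rewrite !addn0; apply: congJ_refl.
rewrite addnS -addSnnS.
apply: (congJ_trans idJ (w := X (i + e) * X l.+1)); first by apply: Jminor; lia.
by apply: IH; lia.
Qed.

(** If S >= j, the leading X_j is set aside and induction applies. Otherwise the greedy product is
    X_S times a power of X_0, and X_i X_S is replaced by X_0 X_(S+i) or, when S + i > j, by X_j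
    X_(S+i-j). *)
Lemma mon_step i r S : (i <= j)%N -> (S <= r * j)%N ->
  J (X i * mon j r S - mon j r.+1 (S + i)).
Proof.
elim: r S => [|r IH] S leij leS.
  have -> : S = 0%N by lia.
  by rewrite /= (minn_idPl _) //; apply: congJ_refl.
have [leSj | leSj] := leqP j S.
  have -> : X i * mon j r.+1 S = X j * (X i * mon j r (S - j)).
    by rewrite /= (minn_idPr leSj) mulrCA.
  have -> : mon j r.+2 (S + i) = X j * mon j r.+1 (S - j + i).
    rewrite [LHS]/= -/(mon j r.+1 _) (minn_idPr _); last lia.
    by congr (_ * mon _ _ _); lia.
  by apply: congJ_mul => //; apply: IH; lia.
have -> : X i * mon j r.+1 S = mon j r 0 * (X i * X S).
  rewrite /= (minn_idPl _) ?(ltnW leSj) // (_ : S - j = 0)%N; last lia.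
  by rewrite mulrA mulrC.
have [leSi | leSi] := leqP (S + i) j.
  have -> : mon j r.+2 (S + i) = mon j r 0 * (X 0 * X (S + i)).
    rewrite /= (minn_idPl leSi) (_ : S + i - j = 0)%N; last lia.
    by rewrite min0n sub0n; ring.
  by apply: congJ_mul => //; apply: (@shift_cong i 0 S); lia.
have -> : mon j r.+2 (S + i) = mon j r 0 * (X (S + i - j) * X (S + (j - S))).
  rewrite /= (minn_idPr _); last lia.
  rewrite (minn_idPl _); last lia.
  rewrite subnKC ?(ltnW leSj) // (_ : S + i - j - j = 0)%N; last lia.
  ring.
have {1}-> : i = (S + i - j + (j - S))%N by lia.
by apply: congJ_mul => //; apply: shift_cong; lia.
Qed.

(** [head_deg] and [head_wt] are the exponents of s and t in the image of the monomial under X_i |->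
    s t^i (i <= j); [tail] holds the variables that are kept. *)
Definition head_deg (m : 'X_{1..n.+1}) : nat := \sum_(i < n.+1 | (i <= j)%N) m i.
Definition head_wt (m : 'X_{1..n.+1}) : nat := \sum_(i < n.+1 | (i <= j)%N) i * m i.
Definition tail (m : 'X_{1..n.+1}) : 'X_{1..n.+1} :=
  [multinom if (i <= j)%N then 0%N else m i | i < n.+1].

Lemma head_wt_le m : (head_wt m <= head_deg m * j)%N.
Proof.
by rewrite big_distrl; apply: leq_sum => i leij; rewrite mulnC leq_mul.
Qed.

Lemma head_degU i m : head_deg (U_(i) + m) = ((i <= j) + head_deg m)%N.
Proof.
rewrite /head_deg (eq_bigr (fun l : 'I__ => (i == l) + m l)%N); last first.
  by move=> l _; rewrite mnmDE mnm1E.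
rewrite big_split /=; congr (_ + _)%N.
have [leij | ltji] := leqP i j.
  rewrite (bigD1 i) //= eqxx big1 // => l /andP[_].
  by rewrite eq_sym => /negPf->.
by rewrite big1 // => l lelj; case: eqP => // il; move: ltji; rewrite il ltnNge lelj.
Qed.

Lemma head_wtU i m :
  head_wt (U_(i) + m) = ((if (i <= j)%N then i : nat else 0) + head_wt m)%N.
Proof.
rewrite /head_wt (eq_bigr (fun l : 'I__ => l * (i == l) + l * m l)%N); last first.
  by move=> l _; rewrite mnmDE mnm1E mulnDr.
rewrite big_split /=; congr (_ + _)%N.
have [leij | ltji] := leqP i j.
  rewrite (bigD1 i) //= eqxx muln1 big1 ?addn0 // => l /andP[_].
  by rewrite eq_sym => /negPf->; rewrite muln0.
rewrite big1 // => l lelj; case: eqP => [il|]; last by rewrite muln0.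
by move: ltji; rewrite il ltnNge lelj.
Qed.

Lemma tailE m (l : 'I_n.+1) : tail m l = if (l <= j)%N then 0%N else m l.
Proof. exact: mnmE. Qed.

Lemma tailU i m :
  tail (U_(i) + m) = ((if (i <= j)%N then 0 else U_(i)) + tail m)%MM.
Proof.
apply/mnmP => l; rewrite mnmDE !tailE mnmDE mnm1E.
have [leij | ltji] := leqP i j.
  rewrite mnm0E add0n; case: ifP => // lelj; case: eqP => [il|] //.
  by rewrite -il leij in lelj.
rewrite mnm1E; case: ifP => // lelj; case: eqP => [il|] //.
by rewrite il ltnNge lelj in ltji.
Qed.

(** Variables are multiplied in one at a time: [mon_step] absorbs those of index at most j, the
    others join the tail. *)
Lemma mon_cong m : (j <= n)%N ->
  J ('X_[m] - mon j (head_deg m) (head_wt m) * 'X_[tail m]).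
Proof.
move=> lejn; elim/mnm_ind: m => [|i m IH].
  have -> : head_deg 0 = 0%N by rewrite /head_deg big1 // => i _; rewrite mnm0E.
  have -> : tail 0 = 0%MM by apply/mnmP => i; rewrite tailE !mnm0E if_same.
  by rewrite mul1r; apply: congJ_refl.
rewrite head_degU head_wtU tailU mpolyXD.
apply: (congJ_trans idJ); first exact: congJ_mul IH.
have [leij | ltji] := leqP i j; last first.
  by rewrite !add0n mpolyXD mulrCA; apply: congJ_refl.
rewrite add0m mulrA ![_ * 'X_[tail m]]mulrC; apply: congJ_mul => //.
rewrite add1n [(i + _)%N]addnC -[X in 'X_X]inord_val.
by apply: mon_step; rewrite ?head_wt_le.
Qed.

End Congruence.

End Columns.

(** * The rational normal columns *)

Section Kernels.

Variables (k : fieldType) (n : nat).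
Notation R := {mpoly k[n.+1]}.
Notation X := (@X k n).
Notation cols := (@cols k n).

(** The inner polynomial variable is s, the outer one t. *)
Definition psi_gen (j : nat) (i : 'I_n.+1) : {poly {poly R}} :=
  if (i <= j)%N then ('X)%:P * 'X^i else ('X_i)%:P%:P.

(* Identifies the 2 x 2 minors of the first [j] columns with the kernel of
   X_i |-> s t^i (i <= j), the other variables being kept. *)
Definition psi (j : nat) : R -> {poly {poly R}} :=
  mmap (polyC \o polyC \o @mpolyC n.+1 k) (psi_gen j).

HB.instance Definition _ j := GRing.RMorphism.on (psi j).

Lemma psiXU j i : psi j 'X_i = psi_gen j i.
Proof. by rewrite /psi mmapX mmap1U. Qed.

Lemma psiX j m : psi j 'X_[m] =
  ('X_[tail j m] *: 'X^(head_deg j m))%:P * 'X^(head_wt j m).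
Proof.
elim/mnm_ind: m => [|i m IH].
  have -> : head_deg j (0%MM : 'X_{1..n.+1}) = 0%N.
    by rewrite /head_deg big1 // => i _; rewrite mnm0E.
  have -> : head_wt j (0%MM : 'X_{1..n.+1}) = 0%N.
    by rewrite /head_wt big1 // => i _; rewrite mnm0E muln0.
  have -> : tail j (0%MM : 'X_{1..n.+1}) = 0%MM.
    by apply/mnmP => i; rewrite tailE !mnm0E if_same.
  by rewrite mpolyX0 rmorph1 !expr0 scale1r mulr1.
rewrite head_degU head_wtU tailU !mpolyXD rmorphM /= IH psiXU /psi_gen.
case: ifP => leij.
  rewrite mpolyX0 mul1r add1n exprS exprD -!mul_polyC !polyCM; ring.
by rewrite !add0n -scalerA -[in RHS]mul_polyC polyCM mulrA.
Qed.

(** Turns psi(p) = 0 into the hypothesis of [binomial_ideal]. *)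
Lemma coef_psi j p a b t : (psi j p)`_b`_a@_t =
  \sum_(m <- msupp p | (head_wt j m, head_deg j m, tail j m) == (b, a, t)) p@_m.
Proof.
rewrite {1}[p]mpolyE rmorph_sum /= coef_sum coef_sum raddf_sum /= [RHS]big_mkcond /=.
apply: eq_bigr => m _; rewrite -mul_mpolyC rmorphM /= psiX /psi mmapC /=.
rewrite !coefCM coefXn !xpair_eqE (eq_sym b).
case: (head_wt j m == b); last by rewrite mulr0 coef0 mulr0 mcoeff0.
rewrite mulr1 coefZ coefXn (eq_sym a); case: (head_deg j m == a); last first.
  by rewrite !mulr0 mcoeff0.
rewrite mulr1 mcoeffCM mcoeffX.
by case: (tail j m == t); rewrite ?mulr1 ?mulr0.
Qed.

Lemma ideal2_cols_minor (cs : seq (R * R)) j : {subset cols j <= cs} ->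
  forall i l, (i < j)%N -> (l < j)%N ->
  ideal2 cs (X i.+1 * X l - X i * X l.+1).
Proof.
move=> sub i l lij llj.
have := minor_ideal2 (sub _ (cols_mem _ _ llj)) (sub _ (cols_mem _ _ lij)).
by rewrite [X l * _]mulrC.
Qed.

(** Monomials with the same image under [psi] share their normal form in [mon_cong], so their
    difference lies in the ideal of minors. *)
Lemma psi_ker j p : (j <= n)%N -> psi j p = 0 -> ideal2 (cols j) p.
Proof.
move=> lejn p0.
pose w m := (head_wt j m, head_deg j m, tail j m : 'X_{1..n.+1}).
apply: (binomial_ideal (ideal2_is_ideal _) (w := w)) => [m1 m2 eq_w | [[b a] t]].
  have tE : tail j m1 = tail j m2 := congr1 snd eq_w.
  have dE : head_deg j m1 = head_deg j m2 := congr1 (fun x => x.1.2) eq_w.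
  have wE : head_wt j m1 = head_wt j m2 := congr1 (fun x => x.1.1) eq_w.
  have cong m := mon_cong (ideal2_is_ideal _) (ideal2_cols_minor (fun c => id)) m lejn.
  apply: (congJ_trans (ideal2_is_ideal _)); first exact: cong.
  by rewrite wE dE tE; apply: congJ_sym; [exact: ideal2_is_ideal | exact: cong].
by rewrite -coef_psi p0 !coef0 mcoeff0.
Qed.

Lemma psi_column i j : (i < j)%N -> (j <= n)%N -> psi j (X i.+1) = 'X * psi j (X i).
Proof.
move=> lij lejn; rewrite /X !psiXU /psi_gen !inordK ?ltnS; try lia.
by rewrite lij (ltnW lij) exprS mulrCA.
Qed.

(** [psi] satisfies y_i = t x_i on the previous columns. If this fails for (x, y), then z is in the
    kernel of [psi]. *)
Lemma nice_column j x y : (j <= n)%N -> 'X * psi j x != psi j y ->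
  forall z f, bd1 (cols j) f (zerov (cols j)) = x * z ->
              bd2 (cols j) f (zerov (cols j)) = y * z -> ideal2 (cols j) z.
Proof.
move=> lejn xy z f fx fy; apply: psi_ker => //.
have psi_cols c : c \in cols j -> psi j c.2 = 'X * psi j c.1.
  by move=> /memcolsP[i lij ->]; apply: psi_column.
exact: (rmorph_column psi_cols xy fx fy).
Qed.

Lemma psi_last j : (j <= n)%N -> psi j (X j) = ('X)%:P * 'X^j.
Proof. by move=> lejn; rewrite psiXU /psi_gen inordK ?leqnn. Qed.

Lemma nice_cols j : (j <= n)%N -> nice_columns (cols j).
Proof.
elim: j => //= j IH ltjn; split; last exact/IH/ltnW.
apply: nice_column; first exact: ltnW.
rewrite psi_last 1?ltnW // psiXU /psi_gen inordK // ltnn mulrCA -exprS.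
(* In degree j + 1 in t, the coefficient of t psi(X_j) is s, while psi(X_(j+1)) is constant in t. *)
apply/negP => /eqP/(congr1 (fun q : {poly {poly R}} => q`_j.+1))/eqP.
by rewrite coefCM coefXn eqxx mulr1 coefC polyX_eq0.
Qed.

Variables (a d : nat).

Definition all_cols : seq (R * R) := (X n ^+ a, X 0 ^+ (a + d)) :: cols n.

Lemma regular_all_cols : regular_seq (unzip1 all_cols).
Proof.
split; last exact: regular_cols.
by move=> c; apply: regular_column.
Qed.

Lemma nice_all_cols : nice_columns all_cols.
Proof.
split; last exact: nice_cols.
apply: nice_column => //; rewrite !rmorphXn /= psi_last // psiXU /psi_gen inordK //=.
rewrite mulr1 !exprMn -!polyC_exp -exprM mulrCA -exprS.
(* Here s^a t^(n a + 1) is compared with s^(a+d), which is constant in t. *)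
apply/negP => /eqP/(congr1 (fun q : {poly {poly R}} => q`_(n * a).+1))/eqP.
by rewrite coefCM coefXn eqxx mulr1 coefC expf_eq0 polyX_eq0 andbF.
Qed.

End Kernels.

(** M divides (s2 - s1) d, hence s2 - s1 < M. With M = m_0, a normal form can be read off its
    weight. *)
Lemma coprime_repr_uniq M d r1 r2 s1 s2 : coprime M d -> (s1 < M)%N -> (s2 < M)%N ->
  (r1 * M + s1 * d = r2 * M + s2 * d)%N -> r1 = r2 /\ s1 = s2.
Proof.
move=> cop lt1 lt2; wlog les : r1 r2 s1 s2 lt1 lt2 / (s1 <= s2)%N.
  move=> H e; have [le|/ltnW le] := leqP s1 s2; first exact: H.
  by have [] := H r2 r1 s2 s1 lt2 lt1 le (esym e).
move=> e; have dvd : (M %| s2 - s1)%N.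
  rewrite -(Gauss_dvdl _ cop) mulnBl; apply/dvdnP; exists (r1 - r2)%N.
  by rewrite mulnBl; lia.
have s12 : s1 = s2.
  have [/dvdn_leq/(_ dvd)|] := ltnP 0 (s2 - s1); lia.
split=> //; move: e; rewrite s12 => /addIn/eqP.
by rewrite eqn_pmul2r ?(leq_ltn_trans _ lt1) // => /eqP.
Qed.

(** * The monomial curve *)

Section Curve.

Variables (k : fieldType) (n a d : nat) (m : nat -> nat).
Notation R := {mpoly k[n.+1]}.
Notation X := (@X k n).
Notation mon := (@mon k n).
Notation J := (ideal2 (all_cols k n a d)).

Hypothesis n_gt0 : (0 < n)%N.
Hypothesis mE : forall i, (i <= n)%N -> m i = ((n * a).+1 + i * d)%N.
Hypothesis cop_d : coprime (n * a).+1 d.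

Let idJ : is_ideal J := ideal2_is_ideal _.

Let Jminor i l : (i < n)%N -> (l < n)%N -> J (X i.+1 * X l - X i * X l.+1).
Proof.
by apply: ideal2_cols_minor => c ccs; rewrite inE ccs orbT.
Qed.

Let Jlast i : (i < n)%N -> J (X n ^+ a * X i.+1 - X 0 ^+ (a + d) * X i).
Proof.
move=> lin; rewrite [X 0 ^+ _ * _]mulrC.
apply: (minor_ideal2 (c := (X n ^+ a, X 0 ^+ (a + d))) (d := (X i, X i.+1))).
  exact: mem_head.
by rewrite inE cols_mem ?orbT.
Qed.

Lemma mon_expand e r S : mon n (e + r) (e * n + S) = X n ^+ e * mon n r S.
Proof.
elim: e => [|e IH]; first by rewrite mul1r.
rewrite addSn [LHS]/= -/(mon n) (minn_idPr _); last by rewrite mulSn -addnA leq_addr.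
by rewrite mulSn -addnA addKn IH exprS mulrA.
Qed.

(** Factors X_0 leave the index sum unchanged and are absorbed by [mon_step]. *)
Lemma mon_pad e r S : (S <= r * n)%N -> J (X 0 ^+ e * mon n r S - mon n (e + r) S).
Proof.
move=> leS; elim: e => [|e IH]; first by rewrite mul1r; apply: congJ_refl.
rewrite exprS -mulrA.
apply: (congJ_trans idJ); first exact: congJ_mul IH.
by rewrite addSn -[S in mon n _.+1 S]addn0; apply: mon_step => //; nia.
Qed.

(* The last column trades m_0 = n a + 1 units of index sum for [d] extra factors, which does
   not change the weight. *)
Lemma mon_reduce r S : (S <= r * n)%N -> (n * a < S)%N ->
  J (mon n r S - mon n (r + d) (S - (n * a).+1)).
Proof.
move=> leS ltS.
(* As S > n a, the greedy product starts with X_n^a X_(i+1), which the last column turns into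
   X_0^(a+d) X_i; [mon_step] and [mon_pad] restore the greedy form. *)
have [S1 SE] : exists S1, S = (a * n + S1.+1)%N by exists (S - (n * a).+1)%N; lia.
have [r1 rE] : exists r1, r = (a + r1.+1)%N by exists (r - a.+1)%N; nia.
subst S r; rewrite mon_expand /= -/(mon n).
have [i iE] : exists i, minn S1.+1 n = i.+1 by exists (minn S1.+1 n).-1; lia.
have lin : (i < n)%N by lia.
set S2 := (S1.+1 - n)%N; rewrite iE mulrA mulrC.
have leS2 : (S2 <= r1 * n)%N by rewrite /S2; nia.
apply: (congJ_trans idJ); first exact: (congJ_mul idJ _ (Jlast lin)).
rewrite mulrCA [mon _ _ _ * _]mulrC.
apply: (congJ_trans idJ (w := X 0 ^+ (a + d) * mon n r1.+1 (S2 + i))).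
  by apply: congJ_mul => //; apply: mon_step => //; lia.
have -> : (a + r1.+1 + d = a + d + r1.+1)%N by lia.
have -> : (a * n + S1.+1 - (n * a).+1 = S2 + i)%N by rewrite /S2; lia.
apply: mon_pad; rewrite mulSn; lia.
Qed.

(** Iterating [mon_reduce] brings the index sum below m_0; the equation records that the weight is
    preserved. *)
Lemma mon_normal r S : (S <= r * n)%N -> exists2 r',
  (r' * (n * a).+1 + S %% (n * a).+1 * d = r * (n * a).+1 + S * d)%N &
  J (mon n r S - mon n r' (S %% (n * a).+1)).
Proof.
elim/ltn_ind: S r => S IH r leS.
have [ltS | leqS] := ltnP S (n * a).+1.
  by exists r; rewrite modn_small //; apply: congJ_refl.
have [||r' r'E cong] := IH (S - (n * a).+1)%N _ (r + d)%N; [lia | nia |].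
have modE : S - (n * a).+1 = S %[mod (n * a).+1].
  by rewrite -(modnDr (S - _)) subnK.
exists r'; rewrite -modE.
  by rewrite r'E mulnDl -addnA [(d * _)%N]mulnC -mulnDl subnKC.
exact: congJ_trans (mon_reduce leS leqS) cong.
Qed.

Definition weight (u : 'X_{1..n.+1}) : nat := \sum_(i < n.+1) m i * u i.

Lemma weightE u :
  weight u = (head_deg n u * (n * a).+1 + head_wt n u * d)%N.
Proof.
rewrite /weight /head_deg /head_wt !big_distrl -big_split [LHS]big_mkcond.
rewrite [RHS]big_mkcond /=; apply: eq_bigr => i _.
have lein : (i <= n)%N by rewrite -ltnS.
by rewrite lein (mE lein) mulnDl [(_ * u i)%N in X in (X + _)%N]mulnC mulnAC.
Qed.

(** Both monomials reduce to greedy products of index sum below m_0, and [coprime_repr_uniq] makes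
    these equal. *)
Lemma weight_cong u v : weight u = weight v -> J ('X_[u] - 'X_[v]).
Proof.
have tail0 w : tail n w = 0%MM :> 'X_{1..n.+1}.
  by apply/mnmP => i; rewrite tailE -ltnS ltn_ord mnm0E.
have norm w : exists2 r, (r * (n * a).+1 + head_wt n w %% (n * a).+1 * d = weight w)%N
    & J ('X_[w] - mon n r (head_wt n w %% (n * a).+1)).
  have [r rE cong] := mon_normal (head_wt_le n w).
  exists r; first by rewrite rE weightE.
  apply: congJ_trans cong => //.
  by have := mon_cong idJ Jminor w (leqnn n); rewrite tail0 mpolyX0 mulr1.
move=> wuv; have [ru ruE congu] := norm u; have [rv rvE congv] := norm v.
have [rE SE] := coprime_repr_uniq cop_d (ltn_pmod _ (ltn0Sn _))
  (ltn_pmod _ (ltn0Sn _)) (etrans ruE (etrans wuv (esym rvE))).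
apply: (congJ_trans idJ congu); rewrite rE SE.
exact: congJ_sym.
Qed.

(** The curve map sends each second-row entry to t^d times the first; for the last column this is (a
    + d) m_0 = a m_n + d. The other inclusion is [binomial_ideal]. *)
Lemma monomial_kernelP p : monomial_kernel m p <-> J p.
Proof.
rewrite /monomial_kernel; split=> [p0 | Jp].
  apply: (binomial_ideal idJ weight_cong) => x.
  have mapX u : mmap1 (fun i : 'I_n.+1 => 'X^(m i) : {poly k}) u = 'X^(weight u).
    rewrite /mmap1 /weight expr_sum; apply: eq_bigr => i _.
    by rewrite exprM.
  have := congr1 (fun q : {poly k} => q`_x) p0.
  rewrite /monomial_map /mmap coef_sum coef0 => p0x.
  rewrite -[RHS]p0x [LHS]big_mkcond; apply: eq_bigr => u _ /=.
  by rewrite mapX coefCM coefXn eq_sym; case: eqP; rewrite ?mulr1 ?mulr0.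
have mapXU i : (i <= n)%N -> mmap (@polyC k) (fun i : 'I_n.+1 => 'X^(m i)) (X i) = 'X^(m i).
  by move=> lein; rewrite mmapX mmap1U inordK.
apply: (@ideal2_ker _ _ (mmap (@polyC k) (fun i : 'I_n.+1 => 'X^(m i))) ('X^d) _ _ _ Jp).
move=> c; rewrite inE => /predU1P[-> | /memcolsP[i lin ->]] /=.
  rewrite !rmorphXn /= !mapXU // -!exprM -exprD !mE //; congr ('X^_); nia.
by rewrite !mapXU ?(ltnW lin) // -exprD !mE ?(ltnW lin) //; congr ('X^_); nia.
Qed.

End Curve.

(** * Parameters of the sequence and the resolution *)

Lemma size_cols (k : fieldType) n j : size (cols k n j) = j.
Proof. by elim: j => //= j ->. Qed.

Lemma size_all_cols (k : fieldType) n a d : size (all_cols k n a d) = n.+1.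
Proof. by rewrite /= size_cols. Qed.

(** The common difference is positive since the sequence increases. A common divisor of m_0 and d
    divides every m_i, hence is 1. *)
Lemma arithmetic_seq_params n m :
  (0 < n)%N -> arithmetic_seq n m -> m 0%N = 1%N %[mod n] ->
  exists a d, [/\ (0 < a)%N, coprime (n * a).+1 d
    & forall i, (i <= n)%N -> m i = ((n * a).+1 + i * d)%N].
Proof.
move=> n_gt0 [gcd1 [m0_gt0 m_incr] [d' md'] m_min] m0_mod.
pose d := (m 1%N - m 0%N)%N.
have m01 : (m 0%N < m 1%N)%N by apply: m_incr.
have d'E : d' = d%:Z.
  by rewrite /d -subzn ?(ltnW m01) // (md' 1%N n_gt0) mul1r addrC addKr.
have md i : (i <= n)%N -> m i = (m 0%N + i * d)%N.
  by move=> lein; apply/eqP; rewrite -eqz_nat md' // d'E PoszD PoszM.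
have [a m0E] : exists a, m 0%N = (n * a).+1.
  have : (n %| m 0%N - 1)%N by rewrite -eqn_mod_dvd //; apply/eqP.
  by move=> /dvdnP[a m0a]; exists a; lia.
exists a, d; split; last by move=> i lein; rewrite -m0E md.
(* If a = 0 then m_0 = 1 and m_1 is a multiple of m_0, against minimal generation. *)
- rewrite lt0n; apply/eqP => a0; apply: (m_min 1%N n_gt0).
  exists (fun i => if i is 0 then m 1%N else 0%N).
  rewrite (bigD1 ord0) //= m0E a0 muln0 muln1 big1 ?addn0 //.
  by move=> i /andP[_]; rewrite -val_eqE /=; case: (val i).
- rewrite -m0E /coprime -dvdn1 -gcd1; apply/dvdn_biggcdP => i _.
  have lein : (i <= n)%N by rewrite -ltnS.
  by rewrite (md i lein); apply: dvdn_add; [exact: dvdn_gcdl | exact/dvdn_mull/dvdn_gcdr].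
Qed.

Theorem theorem2p1 (k : fieldType) (n : nat) (m : nat -> nat) :
  (1 <= n)%N -> arithmetic_seq n m -> m 0%N = 1%N %[mod n] ->
  exists (b : nat -> nat) (d : forall i : nat, 'M[{mpoly k[n.+1]}]_(b i.+1, b i)),
    minimal_free_resolution (monomial_kernel m) d /\
    b 0%N = 1%N /\
    (forall s, (1 <= s <= n)%N -> b s = (s * 'C(n.+1, s.+1))%N) /\
    (forall s, (n < s)%N -> b s = 0%N).
Proof.
move=> n_gt0 m_arith /(arithmetic_seq_params n_gt0 m_arith)[a [d [a_gt0 cop mE]]].
pose cs := all_cols k n a d.
exists (en_rank (size cs)), (en_mx cs).
have rankE s : (0 < s)%N -> en_rank (size cs) s = (s * 'C(n.+1, s.+1))%N.
  by move=> s_gt0; rewrite /en_rank size_en_basis // size_all_cols.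
split; last split=> //.
  split.
    apply: eagon_northcott_free_resolution; first exact: regular_all_cols.
      exact: nice_all_cols.
    by move=> p; apply: monomial_kernelP.
  move=> s r c; apply: (@en_mx_minimal _ _ (@mcoeff n.+1 k 0%MM)).
  have X0 i : (@X k n i)@_0%MM = 0 by rewrite mcoeffX mnm1_eq0.
  move=> x; rewrite inE => /predU1P[-> | /memcolsP[i _ ->]]; last by split; apply: X0.
  (* Positivity of a keeps X_n^a and X_0^(a+d) in the maximal ideal. *)
  by split; rewrite rmorphXn /= X0 expr0n ?addn_eq0 (gtn_eqF a_gt0).
split=> s; first by case/andP=> s_gt0 _; apply: rankE.
by move=> ltns; rewrite rankE ?bin_small ?muln0 // (leq_ltn_trans _ ltns).
Qed.
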